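(* Let $E(m,n)$ denote the expected number of rounds in Urn Solitaire started with $m$ green and $n$ red balls (equivalently, the function determined by the recurrence given in the context). Then $E(1,1)=1$, $E(2,2)=\frac{17}{9}$, $E(3,3)=\frac{143}{50}$, and for all integers $n\ge 1$, $$ -2\bigl(18n^4+159n^3+528n^2+779n+428\bigr)(n+1)^2(n+2)\,E(n,n) $$ $$ +(n+2)\bigl(216n^6+2358n^5+10485n^4+24174n^3+30251n^2+19276n+4800\bigr)\,E(n+1,n+1) $$ $$ +\bigl(-324n^7-4032n^6-21015n^5-59334n^4-97813n^3-93898n^2-48288n-10080\bigr)\,E(n+2,n+2) $$ $$ +2(n+2)\bigl(18n^4+87n^3+159n^2+128n+36\bigr)(2n+5)^2\,E(n+3,n+3)=0 . $$
   Context: Urn Solitaire: an urn contains $m$ green and $n$ red balls. A round consists of drawing balls uniformly at random without replacement, noting the color of the first ball, and continuing to draw until a ball of the other color is drawn; that last ball is returned to the urn. Rounds are repeated, and the game is considered over as soon as the urn contains balls of only one color (or is empty). $E(m,n)$ is the expected number of rounds until the game is over. Equivalently, $E(m,0)=E(0,n)=0$ for all $m,n\ge 0$, and for $m,n\ge 1$, $$E(m,n)=1+\sum_{k=1}^{m}\frac{\binom{m}{k}}{\binom{m+n}{k}}\cdot\frac{n}{m+n-k}\,E(m-k,n)+\sum_{k=1}^{n}\frac{\binom{n}{k}}{\binom{m+n}{k}}\cdot\frac{m}{m+n-k}\,E(m,n-k).$$ *)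

(* Defs.v *)
From HB Require Import structures.
From mathcomp Require Import all_boot all_order all_algebra.
From mathcomp Require Import ring zify.

Set Implicit Arguments.
Unset Strict Implicit.
Unset Printing Implicit Defensive.

Import Order.TTheory GRing.Theory Num.Theory.
Local Open Scope ring_scope.

#[export] Set Warnings "-abstract-large-number".

(* A finitely supported distribution is a list of weighted outcomes; the same
   outcome may occur several times, its probability being the sum of the
   weights. *)
Definition dist (A : Type) : Type := seq (rat * A).

Definition dret (A : Type) (a : A) : dist A := [:: (1, a)].

Definition dbind (A B : Type) (d : dist A) (f : A -> dist B) : dist B :=
  flatten [seq [seq (p.1 * q.1, q.2) | q <- f p.2] | p <- d].

Definition expect (A : Type) (d : dist A) (X : A -> rat) : rat :=
  \sum_(p <- d) p.1 * X p.2.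

Inductive color := Green | Red.

Definition same_color (c c' : color) : bool :=
  match c, c' with Green, Green | Red, Red => true | _, _ => false end.

(* (number of green balls, number of red balls) *)
Definition urn : Type := (nat * nat)%type.

Definition balls (u : urn) : nat := (u.1 + u.2)%N.

Definition put_back (c : color) (u : urn) : urn :=
  match c with Green => (u.1.+1, u.2) | Red => (u.1, u.2.+1) end.

(* Only used on a nonempty urn. When a color is absent, the corresponding
   outcome has weight 0. *)
Definition draw (u : urn) : dist (color * urn) :=
  [:: (u.1%:R / (balls u)%:R, (Green, (u.1.-1, u.2)));
      (u.2%:R / (balls u)%:R, (Red, (u.1, u.2.-1)))].

(* Keep drawing until a ball whose color is not c shows up, and return that
   ball. As long as the other color is present in u, the bound N = balls u on
   the number of draws is never exceeded with positive probability. *)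
Fixpoint draw_until_other (N : nat) (c : color) (u : urn) : dist urn :=
  if N is N'.+1 then
    dbind (draw u) (fun cu =>
      if same_color cu.1 c then draw_until_other N' c cu.2
      else dret (put_back cu.1 cu.2))
  else dret u.

Definition round (u : urn) : dist urn :=
  dbind (draw u) (fun cu => draw_until_other (balls cu.2) cu.1 cu.2).

Definition game_over (u : urn) : bool := (u.1 == 0)%N || (u.2 == 0)%N.

(* Distribution of the number of rounds until the game is over. Every round
   removes at least one ball, so the bound N = balls u on the number of rounds
   is never exceeded with positive probability. *)
Fixpoint rounds (N : nat) (u : urn) : dist nat :=
  if game_over u then dret 0%N
  else if N is N'.+1 then
    dbind (round u) (fun u' => dbind (rounds N' u') (fun k => dret k.+1))
  else dret 0%N.

Definition E (m n : nat) : rat :=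
  expect (rounds (m + n) (m, n)) (fun k => k%:R).

Lemma expect_ret (A : Type) (a : A) X : expect (dret a) X = X a.
Proof. by rewrite /expect big_seq1 mul1r. Qed.

Lemma expect_bind (A B : Type) (d : dist A) (f : A -> dist B) X :
  expect (dbind d f) X = expect d (fun a => expect (f a) X).
Proof.
rewrite /expect /dbind big_flatten big_map /=; apply: eq_bigr => p _.
by rewrite big_map big_distrr; apply: eq_bigr => q _; rewrite /= mulrA.
Qed.

Lemma eq_expect (A : Type) (d : dist A) X Y :
  X =1 Y -> expect d X = expect d Y.
Proof. by move=> XY; apply: eq_bigr => p _; rewrite XY. Qed.

Lemma expectD (A : Type) (d : dist A) X Y :
  expect d (fun a => X a + Y a) = expect d X + expect d Y.
Proof. by rewrite /expect -big_split; apply: eq_bigr => p _; rewrite mulrDr. Qed.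

Lemma expect_draw u X : expect (draw u) X =
  u.1%:R / (balls u)%:R * X (Green, (u.1.-1, u.2))
  + u.2%:R / (balls u)%:R * X (Red, (u.1, u.2.-1)).
Proof. by rewrite /expect /draw big_cons big_seq1. Qed.

(* The urn with a balls of color c and b balls of the other color. *)
Definition mk (c : color) (a b : nat) : urn := if c is Green then (a, b) else (b, a).

Lemma expect_draw_own c a b (X : color -> urn -> rat) (Y : urn -> rat) :
  expect (draw (mk c a b))
    (fun cu => if same_color cu.1 c then X c cu.2
               else Y (put_back cu.1 cu.2)) =
  a%:R / (a + b)%:R * X c (mk c a.-1 b)
  + b%:R / (a + b)%:R * (if b is 0%N then Y (mk c a 1) else Y (mk c a b)).
Proof.
rewrite expect_draw; case: c; rewrite /balls /=; first by case: b.
by rewrite addrC addnC; case: b.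
Qed.

Lemma bin_quotS m n k : (k <= m)%N ->
  'C(m.+1, k.+1)%:R / 'C(m.+1 + n, k.+1)%:R =
  m.+1%:R / (m.+1 + n)%:R * ('C(m, k)%:R / 'C(m + n, k)%:R) :> rat.
Proof.
move=> km.
have nz a : (0 < a)%N -> a%:R != 0 :> rat by rewrite pnatr_eq0 lt0n.
have binS a : 'C(a.+1, k.+1)%:R = a.+1%:R * 'C(a, k)%:R / k.+1%:R :> rat.
  by rewrite -natrM mul_bin_diag natrM mulrC mulKf ?nz.
rewrite addSn !binS; field.
by rewrite -natrD !nat1r !nz ?bin_gt0 ?ltn_addr ?(leq_trans km) ?leq_addr.
Qed.

(* Mean of F (number of balls of color c left) when drawing from mk c m n until
   a ball of the other color shows up: 'C(m, k) / 'C(m + n, k) is the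
   probability that the first k balls all have color c. *)
Definition run_mean (m n : nat) (F : nat -> rat) : rat :=
  \sum_(0 <= k < m.+1)
    'C(m, k)%:R / 'C(m + n, k)%:R * (n%:R / (m + n - k)%:R) * F (m - k)%N.

Lemma run_meanS m n F : (0 < n)%N -> run_mean m.+1 n F =
  m.+1%:R / (m.+1 + n)%:R * run_mean m n F + n%:R / (m.+1 + n)%:R * F m.+1.
Proof.
move=> n0; rewrite /run_mean big_nat_recl // !bin0 subn0 divr1 mul1r addrC.
congr (_ + _); first rewrite big_distrr /= !big_nat.
  apply: eq_bigr => k /andP[_ km].
  by rewrite bin_quotS // addSn !subSS !mulrA.
Qed.

Lemma expect_draw_until_other N c a b F : (a < N)%N -> (0 < b)%N ->
  expect (draw_until_other N c (mk c a b)) F =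
  run_mean a b (fun a' => F (mk c a' b)).
Proof.
elim: N a => // N IH a aN b0 /=.
rewrite expect_bind.
rewrite (@eq_expect _ _ _ (fun cu =>
  if same_color cu.1 c then expect (draw_until_other N c cu.2) F
  else F (put_back cu.1 cu.2))); last first.
  by move=> cu; case: ifP => // _; rewrite expect_ret.
rewrite (expect_draw_own c a b (fun c u => expect (draw_until_other N c u) F)).
case: b b0 IH => // b _ IH; case: a aN => [|a] aN.
  rewrite mul0r mul0r add0r /run_mean big_nat1 !bin0 subn0 /=.
  by rewrite !divr1 !mul1r.
by rewrite IH // run_meanS.
Qed.

Lemma expect_round m n F : (0 < m)%N -> (0 < n)%N ->
  expect (round (m, n)) F =
    \sum_(1 <= k < m.+1)
      'C(m, k)%:R / 'C(m + n, k)%:R * (n%:R / (m + n - k)%:R) * F ((m - k)%N, n)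
  + \sum_(1 <= k < n.+1)
      'C(n, k)%:R / 'C(m + n, k)%:R * (m%:R / (m + n - k)%:R) * F (m, (n - k)%N).
Proof.
have half a b (G : nat -> rat) :
  \sum_(1 <= k < a.+2) 'C(a.+1, k)%:R / 'C(a.+1 + b, k)%:R
      * (b%:R / (a.+1 + b - k)%:R) * G (a.+1 - k)%N
  = a.+1%:R / (a.+1 + b)%:R * run_mean a b G.
  rewrite big_add1 /run_mean big_distrr !big_nat /=.
  apply: eq_bigr => k km.
  by rewrite bin_quotS // addSn !subSS !mulrA.
case: m n => // m [] // n _ _.
have hG : expect (draw_until_other (m + n.+1) Green (m, n.+1)) F
        = run_mean m n.+1 (fun a => F (a, n.+1)).
  by apply: (@expect_draw_until_other _ Green m n.+1 F); lia.
have hR : expect (draw_until_other (m.+1 + n) Red (m.+1, n)) F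
        = run_mean n m.+1 (fun a => F (m.+1, a)).
  by apply: (@expect_draw_until_other _ Red n m.+1 F); lia.
rewrite /round expect_bind expect_draw /= /balls /= hG hR.
rewrite (half _ _ (fun a => F (a, n.+1))); congr (_ + _).
by rewrite [(m.+1 + _)%N]addnC (half _ _ (fun a => F (m.+1, a))).
Qed.

Lemma expect_round1 m n : (0 < m)%N -> (0 < n)%N ->
  expect (round (m, n)) (fun=> 1) = 1.
Proof.
have run1 a b : (0 < b)%N -> run_mean a b (fun=> 1) = 1.
  move=> b0; elim: a => [|a IH].
    rewrite /run_mean big_nat1 /= !bin0 !divr1 mul1r add0n subn0.
    by rewrite divff // pnatr_eq0 -lt0n.
  rewrite run_meanS // IH !mulr1 -mulrDl -natrD divff //.
  by rewrite pnatr_eq0 addSn.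
case: m n => // m [] // n _ _.
have hG : expect (draw_until_other (m + n.+1) Green (m, n.+1)) (fun=> 1) = 1.
  apply: etrans (run1 m n.+1 _) => //.
  by apply: (@expect_draw_until_other _ Green m n.+1 (fun=> 1)); lia.
have hR : expect (draw_until_other (m.+1 + n) Red (m.+1, n)) (fun=> 1) = 1.
  apply: etrans (run1 n m.+1 _) => //.
  by apply: (@expect_draw_until_other _ Red n m.+1 (fun=> 1)); lia.
rewrite /round expect_bind expect_draw /= /balls /= hG hR.
by rewrite !mulr1 -mulrDl -natrD divff // pnatr_eq0.
Qed.

Lemma expect_rounds1 N u : expect (rounds N u) (fun=> 1) = 1.
Proof.
elim: N u => [|N IH] [m n] /=; case: ifP => over; rewrite ?expect_ret //.
rewrite expect_bind -[RHS](@expect_round1 m n); last 2 first.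
- by move: over; rewrite /game_over; case: m.
- by move: over; rewrite /game_over; case: n => //; rewrite orbT.
apply: eq_expect => u; rewrite expect_bind -[RHS](IH u).
by apply: eq_expect => k; rewrite expect_ret.
Qed.

Definition mean_rounds N u : rat := expect (rounds N u) (fun k => k%:R).

Lemma mean_rounds_over N u : game_over u -> mean_rounds N u = 0.
Proof. by case: N => [|N] /= over; rewrite /mean_rounds /= over expect_ret. Qed.

Lemma mean_rounds_step N m n : (0 < m)%N -> (0 < n)%N ->
  mean_rounds N.+1 (m, n) = 1 + expect (round (m, n)) (mean_rounds N).
Proof.
move=> m0 n0; rewrite /mean_rounds /= /game_over /= !gtn_eqF //= expect_bind.
rewrite -[X in _ = X + _](expect_round1 m0 n0) -expectD.
apply: eq_expect => u; rewrite expect_bind -[X in _ = X + _](expect_rounds1 N u).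
by rewrite -expectD; apply: eq_expect => k; rewrite expect_ret nat1r.
Qed.

Lemma mean_rounds_fuel N m n : (m + n <= N)%N -> mean_rounds N (m, n) = E m n.
Proof.
rewrite /E -/(mean_rounds (m + n) (m, n)).
suff H M : forall m n N, (m + n <= M)%N -> (m + n <= N)%N ->
    mean_rounds M (m, n) = mean_rounds N (m, n) by move=> ?; apply/esym/H.
elim: M => [|M IH] {}m {}n {}N leM leN.
  by rewrite !mean_rounds_over // /game_over /=; apply/orP; left; lia.
case: m leM leN => [|m] leM leN; first by rewrite !mean_rounds_over.
case: n leM leN => [|n] leM leN; first by rewrite !mean_rounds_over.
case: N leN => // N leN; rewrite !mean_rounds_step // !expect_round //.
congr (1 + (_ + _)); rewrite !big_nat; apply: eq_bigr => k /andP[k0 kn];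
  by congr (_ * _); apply: IH; lia.
Qed.

Lemma E_m0 m : E m 0 = 0.
Proof. by apply: mean_rounds_over; rewrite /game_over orbT. Qed.

Lemma E_0n n : E 0 n = 0.
Proof. exact: mean_rounds_over. Qed.

Lemma E_rec m n : (0 < m)%N -> (0 < n)%N ->
  E m n = 1
    + \sum_(1 <= k < m.+1)
        'C(m, k)%:R / 'C(m + n, k)%:R * (n%:R / (m + n - k)%:R) * E (m - k) n
    + \sum_(1 <= k < n.+1)
        'C(n, k)%:R / 'C(m + n, k)%:R * (m%:R / (m + n - k)%:R) * E m (n - k).
Proof.
case: m n => // m [] // n _ _.
rewrite {1}/E addSn -/(mean_rounds _ _) mean_rounds_step // expect_round // addrA addSn.
congr (1 + _ + _); rewrite !big_nat; apply: eq_bigr => k /andP[k0 kn];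
  by congr (_ * _); apply: mean_rounds_fuel; lia.
Qed.

(* Main.v *)
(* Write E' (m, n) for the mean of E (., n) over the position at which a green
   run started in (m, n) stops.  Conditioning on one draw gives
     (m + n) E' (m, n) = m E' (m - 1, n) + n E (m, n),
   and multiplying by 'C(m + n, m) turns the problem into the partial
   differential equation
     x (1 - x) (1 - 2 y) K_x + y (1 - y) (1 - 2 x) K_y
       = x y (2 - x - y) / (1 - x - y)
   for K = \sum 'C(m + n, m) E (m, n) / (m + n) x^m y^n.  With X = x (1 - x) and
   Y = y (1 - y) its left-hand side is (1 - 2 x) (1 - 2 y) (X K_X + Y K_Y), and
     2 K = ln (1 - x - y) + (X + Y) / (X - Y) ln ((1 - y) / (1 - x)).
   Hence E (m, n) = (1 + (m + n) f (m, n)) / 'C(m + n, m) - 1 / 2, where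
     \sum f (m, n) x^m y^n
       = x y / ((1 - x - y) (x - y)) ln ((1 - y) / (1 - x))
   obeys an inhomogeneous Pascal rule.  On the diagonal f satisfies a first-order
   recurrence whose inhomogeneity is spanned by a rational function and a
   rational multiple of 'C(2 n, n); eliminating both raises the order to 3. *)
Require Import Defs.
From mathcomp Require Import all_boot all_order all_algebra.
From mathcomp Require Import ring lra zify.

Import Order.TTheory GRing.Theory Num.Theory.
Local Open Scope ring_scope.

(** * The inhomogeneous Pascal rule *)

(** The coefficients [f]: dividing by [1 - x - y] gives the Pascal rule, and
    [x y / (x - y) * ln ((1 - y) / (1 - x))] has coefficient [1 / (a + b + 1)] at
    [x^(a+1) y^(b+1)]. *)
Fixpoint pascal_inv (a : nat) : nat -> rat :=
  if a is a'.+1 then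
    fix row b := if b is b'.+1
                 then pascal_inv a' b + row b' + (a' + b').+1%:R^-1 else 0
  else fun=> 0.

Lemma pascal_invSS a b :
  pascal_inv a.+1 b.+1
  = pascal_inv a b.+1 + pascal_inv a.+1 b + (a + b).+1%:R^-1.
Proof. by []. Qed.

Lemma pascal_inv0n b : pascal_inv 0 b = 0.
Proof. by []. Qed.

Lemma pascal_invn0 a : pascal_inv a 0 = 0.
Proof. by case: a. Qed.

Lemma pascal_invC a b : pascal_inv a b = pascal_inv b a.
Proof.
elim: a b => [|a IHa] b; first by rewrite pascal_invn0.
elim: b => [|b IHb]; first by rewrite pascal_invn0.
by rewrite !pascal_invSS IHa -IHb [(a + b)%N]addnC [X in X + _]addrC.
Qed.

Lemma pascal_inv_cross a b :
  b%:R * pascal_inv a b.+1 + a%:R * pascal_inv a.+1 b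
  = 2 * (a + b)%:R * pascal_inv a b + 1 - 'C(a + b, a)%:R.
Proof.
(* The defect of this identity obeys the homogeneous Pascal rule. *)
elim: a b => [|a IHa] b; first by rewrite !pascal_inv0n bin0; ring.
elim: b => [|b IHb]; first by rewrite !pascal_invn0 addn0 binn; ring.
have := IHa b.+1; have := IHb.
rewrite [pascal_inv a.+1 b.+2]pascal_invSS [pascal_inv a.+2 b.+1]pascal_invSS.
rewrite pascal_invSS !addSn !addnS binS.
have inv k : k.+1%:R * k.+1%:R^-1 = 1 :> rat by rewrite mulfV ?pnatr_eq0.
have := inv (a + b)%N; have := inv (a + b).+1.
set v := _^-1; set w := _^-1; rewrite -!natr1 !natrD => wE vE eqb eqa.
lra.
Qed.

(** * Closed forms for [E] and for its mean over a run *)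

Definition mean_closed (a b : nat) : rat :=
  (1 + (a + b)%:R * pascal_inv a b) / 'C(a + b, a)%:R - 1 / 2.

(** This is [E' (a, b)]; the summand [1 / 2] in the numerator makes it vanish at [a = 0]. *)
Definition run_mean_closed (a b : nat) : rat :=
  (b%:R * pascal_inv a b.+1 + 1 / 2) / 'C(a + b, a)%:R - 1 / 2.

Lemma natr_bin_neq0 a b : 'C(a + b, a)%:R != 0 :> rat.
Proof. by rewrite pnatr_eq0 -lt0n bin_gt0 leq_addr. Qed.

Lemma mean_closedC a b : mean_closed a b = mean_closed b a.
Proof.
by rewrite /mean_closed pascal_invC addnC -(bin_sub (leq_addr a b)) addKn.
Qed.

Lemma natr_mul_binS a b :
  a.+1%:R * 'C(a.+1 + b, a.+1)%:R = (a.+1 + b)%:R * 'C(a + b, a)%:R :> rat.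
Proof. by rewrite -!natrM addSn mul_bin_diag. Qed.

(** Over the common denominator ['C(a.+1 + b, a.+1)] this is the Pascal rule multiplied by
    [b * (a.+1 + b)]. *)
Lemma run_mean_closedS a b : (0 < b)%N ->
  (a.+1 + b)%:R * run_mean_closed a.+1 b
  = a.+1%:R * run_mean_closed a b + b%:R * mean_closed a.+1 b.
Proof.
move=> b0; rewrite /run_mean_closed /mean_closed pascal_invSS.
have a1 : a.+1%:R != 0 :> rat by rewrite pnatr_eq0.
have ab1 : (a.+1 + b)%:R != 0 :> rat by rewrite pnatr_eq0.
have -> : 'C(a + b, a)%:R = a.+1%:R * 'C(a.+1 + b, a.+1)%:R / (a.+1 + b)%:R :> rat.
  by rewrite natr_mul_binS mulrC mulKf.
have := natr_bin_neq0 a.+1 b; move: ab1 a1.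
set c := 'C(_, _)%:R; rewrite addSn -!natr1 !natrD => ab1 a1 c0.
by field; rewrite ?ab1 ?a1 ?c0.
Qed.

(** Both sides obey the same recurrence in [a] and vanish at [a = 0]. The index [i = 0] is kept
    apart because [mean_closed 0 b] is [1 / 2], not 0. *)
Lemma run_meanE (G : nat -> rat) a b : (0 < b)%N -> G 0%N = 0 ->
  (forall i, (0 < i <= a)%N -> G i = mean_closed i b) ->
  run_mean a b G = run_mean_closed a b.
Proof.
move=> b0 G0; elim: a => [|a IH] Ga.
  rewrite /run_mean big_nat1 G0 mulr0 /run_mean_closed pascal_inv0n bin0.
  by rewrite mulr0 add0r divr1 subrr.
have ab1 : (a.+1 + b)%:R != 0 :> rat by rewrite pnatr_eq0.
apply: (mulfI ab1); rewrite run_mean_closedS // run_meanS // Ga ?ltnSn //.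
rewrite IH; last by move=> i /andP[i0 ia]; apply: Ga; rewrite i0 leqW.
by field; rewrite nat1r -natrD.
Qed.

(** The first ball of a round always belongs to its run, so the sums of [E_rec] start at [k = 1];
    splitting off that ball leaves a run with one ball less. *)
Lemma run_mean_tail m n (G : nat -> rat) :
  \sum_(1 <= k < m.+2) 'C(m.+1, k)%:R / 'C(m.+1 + n, k)%:R
      * (n%:R / (m.+1 + n - k)%:R) * G (m.+1 - k)%N
  = m.+1%:R / (m.+1 + n)%:R * run_mean m n G.
Proof.
rewrite big_add1 /run_mean big_distrr !big_nat /=.
apply: eq_bigr => k km.
by rewrite bin_quotS // addSn !subSS !mulrA.
Qed.

Lemma E_run_mean m n :
  E m.+1 n.+1
  = 1 + m.+1%:R / (m.+1 + n.+1)%:R * run_mean m n.+1 (E ^~ n.+1)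
      + n.+1%:R / (m.+1 + n.+1)%:R * run_mean n m.+1 (E m.+1).
Proof.
rewrite E_rec // (run_mean_tail m n.+1 (E ^~ n.+1)).
by rewrite [(m.+1 + n.+1)%N]addnC (run_mean_tail n m.+1 (E m.+1)).
Qed.

Lemma mean_closed_step m n :
  mean_closed m.+1 n.+1
  = 1 + m.+1%:R / (m.+1 + n.+1)%:R * run_mean_closed m n.+1
      + n.+1%:R / (m.+1 + n.+1)%:R * run_mean_closed n m.+1.
Proof.
have mn0 : (m.+1 + n.+1)%:R != 0 :> rat by rewrite pnatr_eq0.
have m0 : m.+1%:R != 0 :> rat by rewrite pnatr_eq0.
have n0 : n.+1%:R != 0 :> rat by rewrite pnatr_eq0.
have c0 := natr_bin_neq0 m.+1 n.+1.
have cm : 'C(m + n.+1, m)%:R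
    = m.+1%:R * 'C(m.+1 + n.+1, m.+1)%:R / (m.+1 + n.+1)%:R :> rat.
  by rewrite natr_mul_binS mulrC mulKf.
have cn : 'C(n + m.+1, n)%:R
    = n.+1%:R * 'C(m.+1 + n.+1, m.+1)%:R / (m.+1 + n.+1)%:R :> rat.
  rewrite -(bin_sub (leq_addr n.+1 m.+1)) addKn [(m.+1 + _)%N]addnC natr_mul_binS.
  by rewrite mulrC mulKf ?pnatr_eq0.
(* Two Pascal steps turn [pascal_inv_cross] at [(m.+1, n.+1)] into a relation between the values
   that occur in the two runs. *)
have cross : n.+1%:R * pascal_inv m n.+2 + m.+1%:R * pascal_inv m.+2 n
    = (m.+1 + n.+1)%:R * pascal_inv m.+1 n.+1 - 'C(m.+1 + n.+1, m.+1)%:R.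
  have := pascal_inv_cross m.+1 n.+1.
  rewrite [pascal_inv m.+1 n.+2]pascal_invSS [pascal_inv m.+2 n.+1]pascal_invSS.
  have : (m.+1 + n.+1)%:R * (m.+1 + n.+1)%:R^-1 = 1 :> rat by rewrite mulfV.
  rewrite -[(m + n.+1).+1]addSn -[(m.+1 + n).+1]addnS.
  by set w := _^-1; rewrite natrD => wE crossS; lra.
rewrite /mean_closed /run_mean_closed cm cn (pascal_invC n).
set c := 'C(_, _)%:R in c0 cross *.
transitivity ((n.+1%:R * pascal_inv m n.+2 + m.+1%:R * pascal_inv m.+2 n + 1) / c
              + 1 / 2).
  by rewrite cross; field.
by field; rewrite c0 !nat1r -natrD mn0 m0 n0.
Qed.

Lemma E_closed m n : (0 < m)%N -> (0 < n)%N -> E m n = mean_closed m n.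
Proof.
have [N] := ubnP (m + n)%N.
elim: N m n => // N IH [|m] [|n] // mnN _ _.
rewrite E_run_mean mean_closed_step.
rewrite (run_meanE (E ^~ n.+1)) ?(run_meanE (E m.+1)) ?E_0n ?E_m0 //.
- by move=> i /andP[i0 im]; rewrite mean_closedC; apply: IH => //; lia.
- by move=> i /andP[i0 im]; apply: IH => //; lia.
Qed.

(** * Recurrences on the diagonal *)

Lemma pascal_inv_diagS n : (0 < n)%N ->
  pascal_inv n.+1 n.+1
  = 4 * pascal_inv n n + (1 - 'C(n + n, n)%:R) / n%:R + (2 * n%:R + 1)^-1.
Proof.
move=> n0; have nn0 : n%:R != 0 :> rat by rewrite pnatr_eq0 -lt0n.
(* By symmetry both neighbours in the Pascal rule equal [pascal_inv n n.+1], which the cross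
   identity determines as [n] is nonzero. *)
have := pascal_inv_cross n n; rewrite pascal_invSS (pascal_invC n.+1 n).
have -> : (n + n).+1%:R = 2 * n%:R + 1 :> rat by rewrite -natr1 natrD; ring.
set f := pascal_inv n n.+1; rewrite natrD => cross.
have -> : f = (n%:R * f + n%:R * f) / (2 * n%:R) by field.
by rewrite cross; field; rewrite nn0 -natrM natr1 pnatr_eq0.
Qed.

Lemma natr_central_binS n :
  'C(n.+1 + n.+1, n.+1)%:R
  = 2 * (2 * n%:R + 1) / (n%:R + 1) * 'C(n + n, n)%:R :> rat.
Proof.
have n1 : n%:R + 1 != 0 :> rat by rewrite natr1 pnatr_eq0.
have := natr_mul_binS n n; have := natr_mul_binS n n.+1.
rewrite [X in _ = _ * X -> _](_ : _ = 'C(n.+1 + n, n.+1)%:R); last first.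
  by rewrite -(bin_sub (leq_addr n.+1 n)) addKn addnC.
rewrite !natrD -!natr1 => eq2 eq1.
apply: (mulfI n1); apply: (mulfI n1); rewrite eq2 mulrCA eq1.
by field.
Qed.

Lemma E_diag n : (0 < n)%N ->
  E n n = (1 + 2 * n%:R * pascal_inv n n) / 'C(n + n, n)%:R - 1 / 2.
Proof. by move=> n0; rewrite E_closed // /mean_closed addnn -mul2n natrM. Qed.

Lemma E_diagS n : (0 < n)%N ->
  let x : rat := n%:R in
  E n.+1 n.+1
  = 2 * (x + 1) ^+ 2 / (x * (2 * x + 1)) * E n n
    - (x + 1) * (3 * x + 2) / (2 * x * (2 * x + 1) ^+ 2) / 'C(n + n, n)%:R
    - 1 / 2.
Proof.
move=> n0 x; rewrite !E_diag // pascal_inv_diagS // natr_central_binS -natr1 -/x.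
have c0 := natr_bin_neq0 n n; have x0 : x != 0 by rewrite pnatr_eq0 -lt0n.
have x1 : x + 1 != 0 by rewrite natr1 pnatr_eq0.
have x2 : 2 * x + 1 != 0 by rewrite -natrM natr1 pnatr_eq0.
by field; rewrite x2 x0 c0 x1.
Qed.

Theorem theorem2 :
  [/\ E 1 1 = 1,
      E 2 2 = 17 / 9,
      E 3 3 = 143 / 50 &
      forall n : nat, (1 <= n)%N ->
        let x : rat := n%:R in
        - 2 * (18 * x ^+ 4 + 159 * x ^+ 3 + 528 * x ^+ 2 + 779 * x + 428)
            * (x + 1) ^+ 2 * (x + 2) * E n n
        + (x + 2)
            * (216 * x ^+ 6 + 2358 * x ^+ 5 + 10485%:R * x ^+ 4
               + 24174%:R * x ^+ 3 + 30251%:R * x ^+ 2 + 19276%:R * x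
               + 4800%:R)
            * E (n + 1) (n + 1)
        + (- 324%:R * x ^+ 7 - 4032%:R * x ^+ 6 - 21015%:R * x ^+ 5
           - 59334%:R * x ^+ 4 - 97813%:R * x ^+ 3 - 93898%:R * x ^+ 2
           - 48288%:R * x - 10080%:R)
            * E (n + 2) (n + 2)
        + 2 * (x + 2)
            * (18 * x ^+ 4 + 87 * x ^+ 3 + 159 * x ^+ 2 + 128 * x + 36)
            * (2 * x + 5) ^+ 2 * E (n + 3) (n + 3)
        = 0].
Proof.
have C1 : 'C(1 + 1, 1) = 2%N by [].
have C2 : 'C(2 + 2, 2) = 6%N by [].
have E11 : E 1 1 = 1 by rewrite E_diag // pascal_invSS pascal_invn0 C1; field.
have E22 : E 2 2 = 17 / 9 by rewrite (E_diagS 1) // E11 C1; field.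
have E33 : E 3 3 = 143 / 50 by rewrite (E_diagS 2) // E22 C2; field.
split=> [|||n n0 x]; [exact: E11 | exact: E22 | exact: E33 |].
rewrite addn1 addn2 addn3.
have e1 := E_diagS n n0; have e2 := E_diagS n.+1 isT; have e3 := E_diagS n.+2 isT.
have cS := natr_central_binS.
rewrite /= -/x in e1; rewrite /= (cS n) -natr1 -/x in e2.
rewrite /= (cS n.+1) (cS n) -!natr1 -/x in e3.
have x0 : 0 < x by rewrite ltr0n.
move: (natr_bin_neq0 n n) e1 e2 e3; set c := 'C(_, _)%:R => c0 e1 e2 e3.
(* Everything is now a combination of [E n n], [1 / c] and 1 over the rational functions of [x]; the
   given polynomials make all three coefficients vanish. *)
rewrite e3 e2 e1; field; rewrite -/x c0.
clear - x0; clearbody x; apply/and5P; split.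
all: by rewrite ?lt0r_neq0 //; lra.
Qed.
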